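(* Let $V_T$ be a set of terminals, $V_N=\{0,1,\dots,n\}$ a finite set of nonterminals, $\Delta$ the set of PEG expressions over $V_T,V_N$, and $P_{exp}:V_N\to\Delta$. Let $\mathbb{F}=\{P\in\mathbb{C}: P=r_0^P\}$. Then for every $P\in\mathbb{F}$ and every $A\in V_N$, $P=\rho(A,P)$.
   Context: PEG expressions $\Delta$ are generated by: $\epsilon$, $[\cdot]$, $[a]$ ($a\in V_T$), $A$ ($A\in V_N$), $e_1;e_2$, $e_1/e_2$, $e*$, $!e$. A property map is $P:V_N\to\{\mathrm{true},\mathrm{false}\}^3$, $\mathbb{P}$ the set of all of them; $P\le P'$ iff for all $A$ and $i\in\{1,2,3\}$, $P(A)_i\Rightarrow P'(A)_i$. Define $g:\Delta\times\mathbb{P}\to\{\mathrm{true},\mathrm{false}\}^3$, $g(e,P)=(\bot(e),z(e),c(e))$, recursively: $g(\epsilon,P)=(\mathrm{false},\mathrm{true},\mathrm{false})$; $g([\cdot],P)=g([a],P)=(\mathrm{true},\mathrm{false},\mathrm{true})$; $g(A,P)=P(A)$; for $e_1;e_2$: $\bot=\bot(e_1)\vee((z(e_1)\vee c(e_1))\wedge\bot(e_2))$, $z=z(e_1)\wedge z(e_2)$, $c=(c(e_1)\wedge(z(e_2)\vee c(e_2)))\vee(z(e_1)\wedge c(e_2))$; for $e_1/e_2$: $\bot=\bot(e_1)\wedge\bot(e_2)$, $z=z(e_1)\vee(\bot(e_1)\wedge z(e_2))$, $c=c(e_1)\vee(\bot(e_1)\wedge c(e_2))$; for $e*$: $(\mathrm{false},\bot(e),c(e))$;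 for $!e$: $(z(e)\vee c(e),\bot(e),\mathrm{false})$. Define $\rho(A,P)\in\mathbb{P}$ by $\rho(A,P)(A)=g(P_{exp}(A),P)$ and $\rho(A,P)(B)=P(B)$ for $B\ne A$. Coherent maps: $\mathbb{C}=\{P\in\mathbb{P}:\forall A\in V_N,\ P\le\rho(A,P)\}$. For $P\in\mathbb{P}$ and $A\in\{0,\dots,n\}$ define $r_n^P=\rho(n,P)$ and, for $A<n$, $r_A^P=r_{A+1}^{\rho(A,P)}$. *)

(* Defs.v *)
From mathcomp Require Import all_boot.

Set Implicit Arguments.
Unset Strict Implicit.
Unset Printing Implicit Defensive.

Inductive peg (VT VN : Type) : Type :=
| PEG_Eps
| PEG_Any
| PEG_Term of VT
| PEG_NonTerm of VN
| PEG_Seq of peg VT VN & peg VT VN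
| PEG_Choice of peg VT VN & peg VT VN
| PEG_Star of peg VT VN
| PEG_Not of peg VT VN.

Arguments PEG_Eps {VT VN}.
Arguments PEG_Any {VT VN}.
Arguments PEG_Term {VT VN} _.
Arguments PEG_NonTerm {VT VN} _.

(* The triple (bot, z, c): bot = may fail, z = may succeed consuming nothing,
   c = may succeed consuming input. *)
Definition props : Type := (bool * bool * bool)%type.
Definition p_bot (t : props) : bool := t.1.1.
Definition p_z (t : props) : bool := t.1.2.
Definition p_c (t : props) : bool := t.2.

Definition propmap (n : nat) : Type := {ffun 'I_n.+1 -> props}.

Definition propmap_le (n : nat) (P P' : propmap n) : Prop :=
  forall A : 'I_n.+1,
    [/\ p_bot (P A) -> p_bot (P' A),
        p_z (P A) -> p_z (P' A) &
        p_c (P A) -> p_c (P' A)].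

Fixpoint g (VT : Type) (n : nat) (e : peg VT 'I_n.+1) (P : propmap n) : props :=
  match e with
  | PEG_Eps => (false, true, false)
  | PEG_Any => (true, false, true)
  | PEG_Term _ => (true, false, true)
  | PEG_NonTerm A => P A
  | PEG_Seq e1 e2 =>
      let t1 := g e1 P in let t2 := g e2 P in
      (p_bot t1 || ((p_z t1 || p_c t1) && p_bot t2),
       p_z t1 && p_z t2,
       (p_c t1 && (p_z t2 || p_c t2)) || (p_z t1 && p_c t2))
  | PEG_Choice e1 e2 =>
      let t1 := g e1 P in let t2 := g e2 P in
      (p_bot t1 && p_bot t2,
       p_z t1 || (p_bot t1 && p_z t2),
       p_c t1 || (p_bot t1 && p_c t2))
  | PEG_Star e1 => let t := g e1 P in (false, p_bot t, p_c t)
  | PEG_Not e1 => let t := g e1 P in (p_z t || p_c t, p_bot t, false)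
  end.

Definition rho (VT : Type) (n : nat) (Pexp : 'I_n.+1 -> peg VT 'I_n.+1)
    (A : 'I_n.+1) (P : propmap n) : propmap n :=
  [ffun B => if B == A then g (Pexp A) P else P B].

Definition coherent (VT : Type) (n : nat) (Pexp : 'I_n.+1 -> peg VT 'I_n.+1)
    (P : propmap n) : Prop :=
  forall A : 'I_n.+1, propmap_le P (rho Pexp A P).

(* [r_rec Pexp k P] is r_(n-k)^P: the recursion on A going up to n is run as
   structural recursion on k = n - A. The defining equations of r are
   [r_max] and [r_lt] below. *)
Fixpoint r_rec (VT : Type) (n : nat) (Pexp : 'I_n.+1 -> peg VT 'I_n.+1)
    (k : nat) (P : propmap n) : propmap n :=
  match k with
  | 0 => rho Pexp ord_max P
  | k'.+1 => r_rec Pexp k' (rho Pexp (inord (n - k)) P)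
  end.

Definition r (VT : Type) (n : nat) (Pexp : 'I_n.+1 -> peg VT 'I_n.+1)
    (A : 'I_n.+1) (P : propmap n) : propmap n :=
  r_rec Pexp (n - A) P.

Lemma r_max (VT : Type) (n : nat) (Pexp : 'I_n.+1 -> peg VT 'I_n.+1)
    (P : propmap n) :
  r Pexp ord_max P = rho Pexp ord_max P.
Proof. by rewrite /r subnn. Qed.

Lemma r_lt (VT : Type) (n : nat) (Pexp : 'I_n.+1 -> peg VT 'I_n.+1)
    (A : 'I_n.+1) (P : propmap n) :
  A < n -> r Pexp A P = r Pexp (inord A.+1) (rho Pexp A P).
Proof.
move=> ltAn; rewrite /r inordK // -[n - A]prednK ?subn_gt0 //= -subnS.
congr (r_rec _ _ (rho _ _ _)); apply: val_inj.
by rewrite /= -subSn // subSS subKn ?inordK // ltnW.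
Qed.

Definition fixed_coherent (VT : Type) (n : nat)
    (Pexp : 'I_n.+1 -> peg VT 'I_n.+1) (P : propmap n) : Prop :=
  coherent Pexp P /\ P = r Pexp ord0 P.

(* Main.v *)
(* Every clause of [g], including the one for [!], is built from conjunctions
   and disjunctions only, so [F : P |-> (A |-> g (Pexp A) P)] is a monotone
   operator on property maps. The map [rho A] refreshes the single coordinate
   [A] through [F], coherence of [P] says [P <= F P], and [r_0] refreshes all
   the coordinates in turn. Refreshing a coordinate can only increase a
   post-fixed point of [F] and yields a post-fixed point again, so the
   successive refreshes form an increasing chain; if it returns to its start,
   it is constant. *)
From HB Require Import structures.
Require Import Defs.
From mathcomp Require Import all_boot order.

Set Implicit Arguments.
Unset Strict Implicit.
Unset Printing Implicit Defensive.

Import Order.TTheory Order.DefaultProdOrder.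

Local Open Scope order_scope.

Section FinfunPointwiseOrder.

Variables (d : Order.disp_t) (I : finType) (T : porderType d).
Implicit Types f g h : {ffun I -> T}.

Definition ffun_le f g : bool := [forall i, f i <= g i].

Lemma ffun_le_refl : reflexive ffun_le.
Proof. by move=> f; apply/forallP. Qed.

Lemma ffun_le_anti : antisymmetric ffun_le.
Proof.
move=> f g /andP[/forallP le_fg /forallP le_gf].
by apply/ffunP => i; apply/le_anti/andP.
Qed.

Lemma ffun_le_trans : transitive ffun_le.
Proof.
move=> g f h /forallP le_fg /forallP le_gh.
by apply/forallP => i; apply: le_trans (le_fg i) (le_gh i).
Qed.

HB.instance Definition _ := Order.Le_isPOrder.Build d {ffun I -> T}
  ffun_le_refl ffun_le_anti ffun_le_trans.

Lemma ffun_leP f g : reflect (forall i, f i <= g i) (f <= g).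
Proof. exact: forallP. Qed.

End FinfunPointwiseOrder.

Section CoordinateUpdates.

Variables (d : Order.disp_t) (I : finType) (T : porderType d).
Variable F : {ffun I -> T} -> {ffun I -> T}.
Implicit Types (f : {ffun I -> T}) (i : I) (s : seq I).

Definition update_at i f : {ffun I -> T} :=
  [ffun j => if j == i then F f i else f j].

Definition update_along s f : {ffun I -> T} :=
  foldl (fun h i => update_at i h) f s.

Lemma update_at_between i f : f <= F f -> f <= update_at i f <= F f.
Proof.
move=> /ffun_leP le_fF.
by apply/andP; split; apply/ffun_leP => j; rewrite ffunE; case: eqP => [->|].
Qed.

Hypothesis F_homo : {homo F : f g / f <= g}.

Lemma update_at_postfixed i f :
  f <= F f -> update_at i f <= F (update_at i f).
Proof.
by case/(update_at_between i)/andP => le_f_upd /le_trans; apply; apply: F_homo.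
Qed.

Lemma le_update_along s f : f <= F f -> f <= update_along s f.
Proof.
elim: s f => [|i s IHs] f //= le_fF.
have /andP[le_f_upd _] := update_at_between i le_fF.
exact: le_trans le_f_upd (IHs _ (update_at_postfixed i le_fF)).
Qed.

Lemma update_along_fixed s f :
  f <= F f -> update_along s f = f -> {in s, forall i, update_at i f = f}.
Proof.
move=> le_fF; elim: s => [|j s IHs] //= fix_js.
have fix_j : update_at j f = f.
  apply/le_anti; have /andP[-> _] := update_at_between j le_fF.
  by rewrite andbT -[leRHS]fix_js le_update_along // update_at_postfixed.
move=> i /[!inE] /predU1P[-> //|]; apply: IHs.
by rewrite -[RHS]fix_js /update_along /= fix_j.
Qed.

End CoordinateUpdates.

Lemma leEimplyb (a b : bool) : (a <= b) = (a ==> b).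
Proof. by case: a b => [] []. Qed.

Lemma leEprops (t t' : props) :
  (t <= t') = [&& p_bot t <= p_bot t', p_z t <= p_z t' & p_c t <= p_c t'].
Proof. by rewrite andbA. Qed.

Lemma propmap_leP (n : nat) (P P' : propmap n) : propmap_le P P' <-> P <= P'.
Proof.
split=> [lePP'|/ffun_leP lePP' A].
  apply/ffun_leP => A; have [le_bot le_z le_c] := lePP' A.
  by rewrite leEprops !leEimplyb; apply/and3P; split; apply/implyP.
have := lePP' A; rewrite leEprops !leEimplyb.
by case/and3P => /implyP le_bot /implyP le_z /implyP le_c.
Qed.

Lemma g_homo (VT : Type) (n : nat) (e : peg VT 'I_n.+1) :
  {homo g e : P P' / P <= P'}.
Proof.
move=> P P' lePP'.
elim: e => [||a|A|e1 IH1 e2 IH2|e1 IH1 e2 IH2|e IH|e IH] //=;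
  first exact/ffun_leP.
(* [&&] and [||] are the meet and the join of [bool]. *)
1,2: move: IH1 IH2; rewrite !leEprops => /and3P[b1 z1 c1] /and3P[b2 z2 c2];
  by apply/and3P; split; do ![apply: leU2 | apply: leI2].
- by move: IH; rewrite !leEprops => /and3P[b z c]; apply/and3P.
- move: IH; rewrite !leEprops => /and3P[b z c].
  by apply/and3P; split=> //; apply: leU2.
Qed.

Section PegUpdates.

Variables (VT : Type) (n : nat) (Pexp : 'I_n.+1 -> peg VT 'I_n.+1).
Implicit Types (A : 'I_n.+1) (P : propmap n).

Definition g_map P : propmap n := [ffun A => g (Pexp A) P].

Lemma g_map_homo : {homo g_map : P P' / P <= P'}.
Proof. by move=> P P' lePP'; apply/ffun_leP => A; rewrite !ffunE g_homo. Qed.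

Lemma rho_update_at A P : rho Pexp A P = update_at g_map A P.
Proof. by apply/ffunP => B; rewrite !ffunE. Qed.

Lemma coherent_postfixed P : coherent Pexp P -> P <= g_map P.
Proof.
move=> cohP; apply/ffun_leP => A.
by have /propmap_leP/ffun_leP/(_ A) := cohP A; rewrite !ffunE eqxx.
Qed.

Lemma r_update_along A P :
  r Pexp A P = update_along g_map (drop A (enum 'I_n.+1)) P.
Proof.
have drop_enum (B : 'I_n.+1) :
    drop B (enum 'I_n.+1) = B :: drop B.+1 (enum 'I_n.+1).
  by rewrite (drop_nth B) ?size_enum_ord // nth_ord_enum.
have [k] := ubnP (n - A); elim: k A P => // k IHk A P lt_nA_k.
rewrite drop_enum /update_along /= -rho_update_at.
have [lt_An|le_nA] := ltnP A n.
  by rewrite r_lt // IHk inordK // subnS prednK ?subn_gt0.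
have -> : A = ord_max by apply/val_inj/anti_leq; rewrite le_nA leq_ord.
by rewrite r_max drop_oversize // size_enum_ord.
Qed.

End PegUpdates.

Theorem theorem3p3 (VT : Type) (n : nat)
    (Pexp : 'I_n.+1 -> peg VT 'I_n.+1) (P : propmap n)
    (hP : fixed_coherent Pexp P) (A : 'I_n.+1) :
  P = rho Pexp A P.
Proof.
case: hP => /coherent_postfixed le_PgP fix_r0.
have fix_along : update_along (g_map Pexp) (enum 'I_n.+1) P = P.
  by rewrite [RHS]fix_r0 r_update_along drop0.
rewrite rho_update_at (update_along_fixed _ le_PgP fix_along) ?mem_enum //.
exact: g_map_homo.
Qed.
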